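(* Let $k$ be a field of characteristic zero and let $k'\subseteq k$ be a subfield of $k$. Suppose that $P\subseteq k[y_1,\dots,y_n]$ is the vanishing ideal of the image of a polynomial map $f:k^m\to k^n$ that is defined over $k'$. Then the algebraic matroid $M(P)$ is $k'$-representable.
   Context: A polynomial map $f:k^m\to k^n$ is a map $f(z)=(f_1(z),\dots,f_n(z))$ with each $f_i\in k[x_1,\dots,x_m]$; it is defined over $k'$ if all coefficients of $f_1,\dots,f_n$ lie in $k'$. The vanishing ideal of the image is $P=\{g\in k[y_1,\dots,y_n] : g(f(z))=0 \text{ for all } z\in k^m\}$ (a prime ideal, since $k$ is infinite). For a prime ideal $P\subseteq k[y_1,\dots,y_n]$, the algebraic matroid $M(P)$ has ground set $\{y_1,\dots,y_n\}$, and a subset $I$ of the variables is independent if and only if $P\cap k[I]=\langle 0\rangle$, where $k[I]$ is the polynomial subring generated by the variables in $I$. A matroid with ground set $E$ is $k'$-representable if there are a $k'$-vector space $V$ and a map $\varphi:E\to V$ such that, for every $I\subseteq E$, $I$ is independent in the matroid if and only if the indexed family $(\varphi(e))_{e\in I}$ is linearly independent over $k'$. *)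

(* Defs.v *)
From HB Require Import structures.
From mathcomp Require Import all_boot all_order all_algebra.
From mathcomp.multinomials Require Import mpoly.

Set Implicit Arguments.
Unset Strict Implicit.
Unset Printing Implicit Defensive.

Import GRing.Theory.
Local Open Scope ring_scope.

(* Independence is a Prop: for algebraic matroids it is not decidable over an
   arbitrary field. *)
Record matroid (E : finType) := Matroid {
  indep : {set E} -> Prop;
  indep0 : indep set0;
  indepS : forall I J : {set E}, I \subset J -> indep J -> indep I;
  indep_augment : forall I J : {set E},
    indep I -> indep J -> (#|I| < #|J|)%N ->
    exists2 e : E, e \in J :\: I & indep (e |: I)
}.

(* [free] is about sequences in a finite-dimensional space; here V is an
   arbitrary vector space and the family is indexed, so phi need not be
   injective on I for the definition to make sense. *)
Definition lin_indep (K : fieldType) (V : lmodType K) (E : finType)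
    (phi : E -> V) (I : {set E}) : Prop :=
  forall c : E -> K,
    \sum_(e in I) c e *: phi e = 0 -> forall e, e \in I -> c e = 0.

Definition representable (K : fieldType) (E : finType) (M : matroid E) : Prop :=
  exists (V : lmodType K) (phi : E -> V),
    forall I : {set E}, indep M I <-> lin_indep phi I.

(* A polynomial map k^m -> k^n is given by its components f_i. *)
Definition poly_map (k : fieldType) (m n : nat) := 'I_n -> {mpoly k[m]}.

Definition poly_map_eval (k : fieldType) (m n : nat) (f : poly_map k m n)
    (z : 'I_m -> k) : 'I_n -> k :=
  fun i => (f i).@[z].

(* The subfield k' of k is given by a field embedding, necessarily injective. *)
Definition defined_over (k' k : fieldType) (iota : {rmorphism k' -> k})
    (m n : nat) (f : poly_map k m n) : Prop :=
  forall (i : 'I_n) (a : 'X_{1..m}), exists c : k', (f i)@_a = iota c.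

Definition vanishing_ideal (k : fieldType) (m n : nat) (f : poly_map k m n)
    (g : {mpoly k[n]}) : Prop :=
  forall z : 'I_m -> k, g.@[poly_map_eval f z] = 0.

(* k[I], the k-subalgebra of k[y_1, ..., y_n] generated by the y_i, i \in I. *)
Inductive in_subring (k : fieldType) (n : nat) (I : {set 'I_n}) :
    {mpoly k[n]} -> Prop :=
| InSubringC c : in_subring I c%:MP
| InSubringX i : i \in I -> in_subring I 'X_i
| InSubringD p q : in_subring I p -> in_subring I q -> in_subring I (p + q)
| InSubringM p q : in_subring I p -> in_subring I q -> in_subring I (p * q).

Lemma in_subringP (k : fieldType) (n : nat) (I : {set 'I_n}) (p : {mpoly k[n]}) :
  in_subring I p <->
  (forall a : 'X_{1..n}, a \in msupp p -> forall i, a i != 0%N -> i \in I).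
Proof.
split.
  elim=> {p} [c|i Ii|p q _ IHp _ IHq|p q _ IHp _ IHq] a.
  - rewrite msuppC; case: ifP => _; rewrite ?inE // => /eqP-> i.
    by rewrite mnm0E.
  - rewrite msuppX inE => /eqP-> j; rewrite mnm1E.
    by case: (i =P j) => [<-|].
  - by move/msuppD_le; rewrite mem_cat => /orP[/IHp|/IHq].
  - move/msuppM_le => /allpairsP[[b c] /= [bp cq ->]] i.
    rewrite mnmDE addn_eq0 negb_and => /orP[].
      exact: IHp.
    exact: IHq.
have in1 : in_subring I (1 : {mpoly k[n]}) by rewrite -mpolyC1; constructor.
move=> Ip; rewrite [p]mpolyE big_seq.
apply: (big_ind (in_subring I)) => [||a /Ip Ia].
- by rewrite -(mpolyC0 n k); constructor.
- by move=> *; constructor.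
rewrite -mul_mpolyC; constructor; first by constructor.
rewrite mpolyXE_id; apply: (big_ind (in_subring I)) => // [*|i _].
  by constructor.
case: (posnP (a i)) => [->|]; first by rewrite expr0.
rewrite lt0n => /Ia Ii; elim: (a i) => [|d IHd]; first by rewrite expr0.
by rewrite exprS; constructor=> //; constructor.
Qed.

(* M is M(P), the variable y_i being identified with its index i: the set I is
   independent iff the intersection of P and k[I] is {0}. *)
Definition is_algebraic_matroid (k : fieldType) (n : nat)
    (P : {mpoly k[n]} -> Prop) (M : matroid 'I_n) : Prop :=
  forall I : {set 'I_n},
    indep M I <-> (forall g : {mpoly k[n]}, P g /\ in_subring I g <-> g = 0).

(* Main.v *)
(* Differentiating an algebraic relation of minimal degree shows, in characteristic
   zero, that the [f i] with [i] in [I] are algebraically independent iff the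
   corresponding rows of the Jacobian matrix of [f] are linearly independent over
   the field of rational functions. Linear independence means that some maximal
   minor is nonzero; the minors have coefficients in [k'], and [k'] is infinite, so
   a single point [z] of [k'^m] avoids the zeros of all the nonzero minors. The
   Jacobian matrix at [z] then represents the matroid over [k']. *)
Require Import Defs.
From mathcomp Require Import all_boot all_order all_algebra.
From mathcomp.multinomials Require Import mpoly.
From Stdlib Require Import Classical.

Set Implicit Arguments.
Unset Strict Implicit.
Unset Printing Implicit Defensive.

Import GRing.Theory.
Local Open Scope ring_scope.

(** * Polynomials in characteristic zero *)

(** Eliminating this membership gives induction on polynomials: constants, variables, sums,
    products. *)
Lemma in_subringT (k : fieldType) n (p : {mpoly k[n]}) : in_subring setT p.
Proof. by apply/in_subringP => a _ i _; rewrite inE. Qed.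

(** The chain rule, by induction on [p]. The derivation [D] is abstract so as to cover both [deriv]
    on univariate polynomials and the partial derivatives [mderiv j]. *)
Lemma mmap_derivation (k : fieldType) (S : comNzRingType) n
    (h : {rmorphism k -> S}) (u : 'I_n -> S) (D : {additive S -> S}) :
    (forall x y, D (x * y) = D x * y + x * D y) -> (forall c, D (h c) = 0) ->
  forall p, D (mmap h u p) = \sum_i mmap h u p^`M(i) * D (u i).
Proof.
move=> DM Dh p; elim: (in_subringT p) => {p} [c|i _|p q _ IHp _ IHq|p q _ IHp _ IHq].
- rewrite mmapC Dh big1 // => i _.
  by rewrite mderivC mmap0 mul0r.
- rewrite mmapX mmap1U (bigD1 i) //= mderivX mnm1E eqxx scale1r.
  rewrite -[X in (X - _)%MM]add0m addmK mpolyX0.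
  rewrite rmorph1 mul1r big1 ?addr0 // => j ne_ji.
  by rewrite mderivX mnm1E eq_sym (negPf ne_ji) scale0r rmorph0 mul0r.
- rewrite mmapD raddfD IHp IHq -big_split; apply: eq_bigr => i _.
  by rewrite mderivD mmapD mulrDl.
- rewrite rmorphM DM IHp IHq mulr_suml mulr_sumr -big_split.
  apply: eq_bigr => i _; rewrite mderivM rmorphD !rmorphM /= mulrDl.
  by rewrite mulrA [in LHS]mulrAC.
Qed.

Section CharZero.
Context (k : fieldType) (k0 : [pchar k] =i pred0).

Lemma pchar0_natr_eq0 j : (j%:R == 0 :> k) = (j == 0%N).
Proof. by move/pcharf0P: k0; apply. Qed.

(** If [a i] is positive, the derivative has at [a - U_(i)] the coefficient of [p] at [a] multiplied
    by [a i], which is nonzero in characteristic zero. *)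
Lemma mderiv_eq0 n (p : {mpoly k[n]}) i :
  p^`M(i) = 0 -> forall a, a \in msupp p -> a i = 0%N.
Proof.
move=> dp0 a; rewrite mcoeff_msupp; case E: (a i) => [//|b] /eqP[].
have Ea : a = (a - U_(i) + U_(i))%MM.
  by apply/mnmP=> j; rewrite mnmDE mnmBE mnm1E subnK //; case: eqP => // <-; rewrite E.
have /eqP := mcoeff_mderiv i p (a - U_(i))%MM.
rewrite -Ea dp0 mcoeff0 eq_sym -mulr_natr mulf_eq0 => /orP[/eqP//|].
by rewrite pchar0_natr_eq0.
Qed.

Lemma msize_mderiv n (p : {mpoly k[n]}) i :
  p != 0 -> (msize p^`M(i) < msize p)%N.
Proof.
move=> p0; have [->|dp0] := eqVneq p^`M(i) 0; first by rewrite msize0 lt0n msize_poly_eq0.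
rewrite -mlead_deg //; have := mlead_supp dp0.
rewrite mcoeff_msupp mcoeff_mderiv => h.
have /msize_mdeg_lt : (mlead p^`M(i) + U_(i))%MM \in msupp p.
  by rewrite mcoeff_msupp; apply: contraNneq h => ->; rewrite mul0rn.
by rewrite mdegD mdeg1 addn1.
Qed.

Lemma mderiv_all_eq0 n A (G : {mpoly k[n]}) :
  in_subring A G -> (forall i, i \in A -> G^`M(i) = 0) -> G = (G@_0)%:MP.
Proof.
move=> /in_subringP GA dG0; apply/mpolyP => a; rewrite mcoeffC.
have [<-|a0] := eqVneq 0%MM a; first by rewrite mulr1.
rewrite mulr0; apply: memN_msupp_eq0; apply: contraNN a0 => aG.
apply/eqP/mnmP => i; rewrite mnm0E; apply/esym/eqP; apply: contraT => ai.
by have /eqP := mderiv_eq0 (dG0 i (GA a aG i ai)) aG; rewrite (negPf ai).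
Qed.

(** The first [size q] natural numbers are distinct in [k], which is one root too many for a nonzero
    [q]. *)
Lemma poly_vanish_eq0 (q : {poly k}) : (forall t, q.[t] = 0) -> q = 0.
Proof.
move=> q0; apply/eqP; apply: contraT => nz_q.
pose rs := [seq j%:R : k | j <- iota 0 (size q)].
have nat_inj : injective (fun j => j%:R : k).
  have le_inj a b : (a <= b)%N -> a%:R = b%:R :> k -> a = b.
    move=> ab /esym/eqP; rewrite -subr_eq0 -natrB // pchar0_natr_eq0 subn_eq0 => ba.
    by apply/eqP; rewrite eqn_leq ab.
  move=> a b; case/orP: (leq_total a b) => [ab /le_inj->//|ba /esym/le_inj->//].
have := max_poly_roots (rs := rs) nz_q.
rewrite size_map size_iota ltnn map_inj_uniq // iota_uniq; apply => //.
by apply/allP => t _; rewrite /root q0.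
Qed.

(** Induction on the size: the partial derivatives of [p] vanish everywhere too, hence are zero, so
    [p] is a constant whose value is 0. *)
Lemma mpoly_vanish_eq0 n (p : {mpoly k[n]}) : (forall z, p.@[z] = 0) -> p = 0.
Proof.
have [s] := ubnP (msize p); elim: s p => // s IHs p /ltnSE-le_ps p0.
apply/eqP; apply: contraT => nz_p.
have dp0 i : p^`M(i) = 0.
  apply: IHs => [|z]; first exact: leq_trans (msize_mderiv i nz_p) le_ps.
  (* The line through [z] in direction [i]. The restriction of [p] to it is the zero polynomial, and
     its derivative at 0 is the partial derivative of [p] at [z]. *)
  pose u j : {poly k} := (z j)%:P + (j == i)%:R *: 'X.
  have evu q t : (mmap polyC u q).[t] = q.@[fun j => z j + (j == i)%:R * t].
    elim: (in_subringT q) => {q} [c|j _|q r _ IHq _ IHr|q r _ IHq _ IHr].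
    - by rewrite mmapC hornerC mevalC.
    - by rewrite mmapX mmap1U mevalXU /u !hornerE.
    - by rewrite mmapD hornerD IHq IHr mevalD.
    - by rewrite rmorphM hornerM IHq IHr mevalM.
  have := mmap_derivation (h := polyC) u (D := deriv) (@derivM _) (@derivC _) p.
  rewrite (poly_vanish_eq0 (q := mmap _ _ _)) => [|t]; last by rewrite evu.
  rewrite raddf0 (bigD1 i) //= big1 => [|j /negPf ne_ji]; last first.
    by rewrite /u ne_ji scale0r addr0 derivC mulr0.
  rewrite addr0 /u eqxx scale1r derivD derivC derivX add0r mulr1 => /esym.
  move/(congr1 (horner^~ 0)); rewrite evu horner0 => <-.
  by apply: meval_eq => j; rewrite mulr0 addr0.
have pC := mderiv_all_eq0 (in_subringT p) (fun i _ => dp0 i).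
have := p0 (fun=> 0); rewrite pC mevalC => p00.
by move: nz_p; rewrite pC p00 mpolyC0 eqxx.
Qed.

End CharZero.

(** * Linear independence *)

Definition rows_in (R : nzRingType) (E : finType) p (v : E -> 'rV[R]_p)
    (I : {set E}) : 'M[R]_(#|I|, p) :=
  \matrix_(i < #|I|) v (enum_val i).

Lemma minor_map (R S : comNzRingType) (phi : {rmorphism R -> S}) (E : finType) p
    (v : E -> 'rV[R]_p) (w : E -> 'rV[S]_p) (I : {set E}) (h : 'I_#|I| -> 'I_p) :
    (forall e, w e = map_mx phi (v e)) ->
  \det (colsub h (rows_in w I)) = phi (\det (colsub h (rows_in v I))).
Proof.
by move=> wE; rewrite -det_map_mx; congr (\det _); apply/matrixP => i j; rewrite !mxE wE mxE.
Qed.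

Section LinearIndependence.
Context (K : fieldType) (E : finType).

Lemma lin_indepS (V : lmodType K) (phi : E -> V) (I J : {set E}) :
  I \subset J -> lin_indep phi J -> lin_indep phi I.
Proof.
move=> sIJ Jfree c c0 e Ie.
have := Jfree (fun e => if e \in I then c e else 0) _ e (subsetP sIJ e Ie).
rewrite Ie; apply; rewrite (big_setID I) /= (setIidPr sIJ).
rewrite [X in _ + X]big1 => [|i]; last by rewrite inE => /andP[/negPf-> _]; rewrite scale0r.
by rewrite addr0 -[RHS]c0; apply: eq_bigr => i ->.
Qed.

Lemma lin_indep0 (V : lmodType K) (phi : E -> V) : lin_indep phi set0.
Proof. by move=> c _ e; rewrite inE. Qed.

Context (p : nat) (phi : E -> 'rV[K]_p).

Lemma lin_indepP (I : {set E}) : lin_indep phi I <-> row_free (rows_in phi I).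
Proof.
split=> [Ifree|].
  apply: inj_row_free => u; rewrite mulmx_sum_row => u0; apply/rowP => i.
  pose c e := u 0 (enum_rank_in (enum_valP i) e).
  rewrite mxE; have := Ifree c _ (enum_val i) (enum_valP i).
  rewrite /c enum_valK_in; apply; rewrite -[RHS]u0 [LHS]big_enum_val.
  by apply: eq_bigr => j _; rewrite enum_valK_in rowK.
move=> Ifree c c0 e Ie.
pose u : 'rV[K]_#|I| := \row_i c (enum_val i).
have /(congr1 (mulmxr (pinvmx (rows_in phi I)))) : u *m rows_in phi I = 0.
  rewrite mulmx_sum_row -[RHS]c0 [RHS]big_enum_val.
  by apply: eq_bigr => j _; rewrite mxE rowK.
rewrite /= -mulmxA mulmxVp // mulmx1 mul0mx => /rowP /(_ (enum_rank_in Ie e)).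
by rewrite !mxE enum_rankK_in.
Qed.

Lemma lin_indep_card (I : {set E}) : lin_indep phi I -> (#|I| <= p)%N.
Proof. by move=> /lin_indepP /eqP <-; apply: rank_leq_col. Qed.

Lemma row_in_sub (I : {set E}) e : e \in I -> (phi e <= rows_in phi I)%MS.
Proof.
by move=> Ie; rewrite -(enum_rankK_in Ie Ie) -(rowK (fun i => phi (enum_val i))) row_sub.
Qed.

Lemma lin_indepU1 (I : {set E}) e : lin_indep phi I ->
  ~~ (phi e <= rows_in phi I)%MS -> lin_indep phi (e |: I).
Proof.
move=> Ifree Ne c.
have eI : e \notin I by apply: contraNN Ne; apply: row_in_sub.
rewrite big_setU1 //= => c0.
have ce0 : c e = 0.
  apply/eqP; apply: contraNT Ne => ce0.
  have -> : phi e = (c e)^-1 *: - \sum_(i in I) c i *: phi i.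
    move/eqP: c0; rewrite addr_eq0 => /eqP <-.
    by rewrite scalerA mulVf // scale1r.
  apply: scalemx_sub; rewrite eqmx_opp; apply: summx_sub => i Ii.
  by apply: scalemx_sub; apply: row_in_sub.
move: c0; rewrite ce0 scale0r add0r => c0 i.
by rewrite inE => /orP[/set1P->//|]; apply: Ifree.
Qed.

Lemma lin_indep_augment (I J : {set E}) :
    lin_indep phi I -> lin_indep phi J -> (#|I| < #|J|)%N ->
  exists2 e, e \in J :\: I & lin_indep phi (e |: I).
Proof.
move=> Ifree Jfree ltIJ.
have /row_subPn[i Ni] : ~~ (rows_in phi J <= rows_in phi I)%MS.
  apply: contraTN ltIJ => /mxrankS; rewrite -leqNgt.
  by move/lin_indepP/eqP: Ifree => ->; move/lin_indepP/eqP: Jfree => ->.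
rewrite rowK in Ni; exists (enum_val i); last exact: lin_indepU1.
by rewrite inE enum_valP andbT; apply: contraNN Ni; apply: row_in_sub.
Qed.

Definition linear_matroid : matroid E :=
  Matroid (@lin_indep0 _ phi) (@lin_indepS _ phi) lin_indep_augment.

(** Full row rank means that some choice of columns is invertible. A repeated column only gives a
    zero minor, so [h] may range over all functions, which form a finite type. *)
Lemma lin_indep_minor (I : {set E}) : lin_indep phi I <->
  exists h : {ffun 'I_#|I| -> 'I_p}, \det (colsub h (rows_in phi I)) != 0.
Proof.
split=> [/lin_indepP Ifree|[h h0]].
  (* [fullrankfun] selects rows, so it is applied to the transpose in order to select columns. *)
  have /eqP/eqP fullT : row_full (rows_in phi I)^T by rewrite /row_full mxrank_tr.
  exists (fullrankfun fullT).
  have := fullrowsub_unit fullT.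
  by rewrite -unitmx_tr trmx_mxsub trmxK unitmxE unitfE.
apply/lin_indepP; apply: inj_row_free => u u0.
have /(congr1 (mulmxr (invmx (colsub h (rows_in phi I))))) : u *m colsub h (rows_in phi I) = 0.
  by rewrite mulmx_colsub u0; apply/matrixP=> i j; rewrite !mxE.
by rewrite /= mulmxK ?mul0mx // unitmxE unitfE.
Qed.

End LinearIndependence.

(** * Algebraic independence *)

(** A homogeneous linear system with more unknowns, indexed by [A], than equations, indexed by [C],
    has a nonzero solution. *)
Lemma lin_relation (K : fieldType) (T C : finType) (A : {set T}) (e : T -> C -> K) :
    (#|C| < #|A|)%N ->
  exists c : T -> K, (exists2 t, t \in A & c t != 0) /\
    forall j, \sum_(t in A) c t * e t j = 0.
Proof.
move=> ltCA; pose phi t : 'rV[K]_#|C| := \row_j e t (enum_val j).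
have /not_all_ex_not[c cP] : ~ lin_indep phi A.
  by move/lin_indep_card; rewrite leqNgt ltCA.
have [c0 /not_all_ex_not[t tP]] := imply_to_and _ _ cP.
have [At /eqP ct] := imply_to_and _ _ tP.
exists c; split=> [|j]; first by exists t.
move/rowP/(_ (enum_rank j)): c0; rewrite !mxE summxE => c0; rewrite -[RHS]c0.
by apply: eq_bigr => i _; rewrite !mxE enum_rankK.
Qed.

Lemma in_subring_mderiv (k : fieldType) n (A : {set 'I_n}) (G : {mpoly k[n]}) i :
  in_subring A G -> in_subring A G^`M(i).
Proof.
move=> /in_subringP GA; apply/in_subringP => a; rewrite mcoeff_msupp mcoeff_mderiv => aG j aj.
apply: (GA (a + U_(i))%MM); last by rewrite mnmDE addn_eq0 negb_and aj.
by rewrite mcoeff_msupp; apply: contraNneq aG => ->; rewrite mul0rn.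
Qed.

Lemma mderiv_notin (k : fieldType) n (A : {set 'I_n}) (G : {mpoly k[n]}) i :
  in_subring A G -> i \notin A -> G^`M(i) = 0.
Proof.
move=> /in_subringP GA; apply: contraNeq => /mlead_supp.
rewrite mcoeff_msupp mcoeff_mderiv => aG.
apply: (GA (mlead G^`M(i) + U_(i))%MM); last by rewrite mnmDE mnm1E eqxx addn1.
by rewrite mcoeff_msupp; apply: contraNneq aG => ->; rewrite mul0rn.
Qed.

Section AlgebraicIndependence.
Context (k : fieldType) (m : nat).

Definition subst n (w : 'I_n -> {mpoly k[m]}) (G : {mpoly k[n]}) : {mpoly k[m]} :=
  mmap (@mpolyC m k) w G.

Definition alg_indep n (w : 'I_n -> {mpoly k[m]}) (A : {set 'I_n}) : Prop :=
  forall G, in_subring A G -> subst w G = 0 -> G = 0.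

(** Unlike [msize], which is the degree plus one, these bounds simply add up under products. *)
Definition deg_le (d : nat) (p : {mpoly k[m]}) :=
  forall a, a \in msupp p -> (mdeg a <= d)%N.

Lemma deg_leM d e p q : deg_le d p -> deg_le e q -> deg_le (d + e) (p * q).
Proof.
move=> dp eq a /msuppM_le /allpairsP[[b c] /= [/dp db /eq ec ->]].
by rewrite mdegD leq_add.
Qed.

Lemma deg_le1 : deg_le 0 1.
Proof. by move=> a; rewrite msupp1 inE => /eqP->; rewrite mdeg0. Qed.

Lemma deg_leX d p e : deg_le d p -> deg_le (d * e) (p ^+ e).
Proof.
move=> dp; elim: e => [|e IHe]; first by rewrite expr0 muln0; apply: deg_le1.
by rewrite exprS mulnS; apply: deg_leM.
Qed.

Lemma deg_le_prod (I : finType) (d : I -> nat) (p : I -> {mpoly k[m]}) :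
  (forall i, deg_le (d i) (p i)) -> deg_le (\sum_i d i) (\prod_i p i).
Proof.
move=> dp; apply: (big_ind2 deg_le) => //; first exact: deg_le1.
by move=> *; apply: deg_leM.
Qed.

(** A counting argument. The monomials in the variables of [A] with exponents at most [D] number
    [D.+1 ^ #|A|], while their images under [w] have degree at most [B], linear in [D], hence
    involve at most [B.+1 ^ m] monomials. If [#|A|] exceeds [m], a large [D] forces a linear
    relation between the images. *)
Lemma alg_indep_card n (w : 'I_n -> {mpoly k[m]}) A :
  alg_indep w A -> (#|A| <= m)%N.
Proof.
move=> Aind; rewrite leqNgt; apply/negP => ltmA.
pose d := (\max_i msize (w i))%N.
have wd i : deg_le d (w i).
  by move=> a /msize_mdeg_lt /ltnW /leq_trans; apply; apply: (leq_bigmax i).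
(* Since [B.+1] is at most [(#|A| * d).+1 * D.+1], its [m]-th power is at most [D * D.+1 ^ m], which
   is below [D.+1 ^ m.+1]. *)
pose D := ((#|A| * d).+1 ^ m)%N; pose B := (#|A| * d * D)%N.
(* Exponent vectors with value 0 outside [A]. *)
pose T := [set t in pffun_on (@ord0 D) (mem A) predT].
have cardT : #|T| = (D.+1 ^ #|A|)%N by rewrite cardsE card_pffun_on card_ord.
pose mon (t : {ffun 'I_n -> 'I_D.+1}) := [multinom (t i : nat) | i < n].
have mon_inj : injective mon.
  by move=> s t /mnmP st; apply/ffunP => i; apply/val_inj; have := st i; rewrite !mnmE.
pose col (a : {ffun 'I_m -> 'I_B.+1}) := [multinom (a i : nat) | i < m].
(* One unknown for each monomial [mon t], one equation for each coefficient in the box of exponents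
   at most [B]. *)
have [|c [[t0 Tt0 ct0] crel]] := lin_relation (T := {ffun 'I_n -> 'I_D.+1})
    (C := {ffun 'I_m -> 'I_B.+1}) (A := T) (fun t a => (subst w 'X_[mon t])@_(col a)).
  rewrite cardT card_ffun !card_ord.
  apply: (@leq_trans (D.+1 ^ m.+1)); last by rewrite leq_pexp2l.
  apply: (@leq_ltn_trans (((#|A| * d).+1 * D.+1) ^ m)).
    have leB : (B.+1 <= (#|A| * d).+1 * D.+1)%N.
      by rewrite mulSn mulnS addSn ltnS addnA leq_addl.
    by case: (posnP m) => [->|m0]; rewrite ?expn0 ?leq_exp2r.
  by rewrite expnMn expnS ltn_pmul2r ?expn_gt0.
pose G := \sum_(t in T) c t *: 'X_[mon t].
have Gco t : t \in T -> G@_(mon t) = c t.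
  move=> Tt; rewrite /G raddf_sum (bigD1 t) //= mcoeffZ mcoeffX eqxx mulr1 big1 ?addr0 // => s.
  by case/andP=> _ /negPf st; rewrite mcoeffZ mcoeffX (inj_eq mon_inj) st mulr0.
have G0 : G = 0.
  apply: Aind.
    apply: (big_ind (in_subring A)) => [||t].
    - by rewrite -mpolyC0; constructor.
    - by move=> *; constructor.
    rewrite inE => /pffun_onP[/subsetP tA _]; apply/in_subringP => a.
    move=> /msuppZ_le; rewrite msuppX inE => /eqP-> i; rewrite mnmE => ti.
    by apply: tA; rewrite inE.
  apply/mpolyP => a; rewrite mcoeff0.
  have -> : subst w G = \sum_(t in T) (c t)%:MP * subst w 'X_[mon t].
    rewrite /subst /G (raddf_sum (mmap (@mpolyC m k) w)).
    by apply: eq_bigr => t _; exact: mmapZ.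
  rewrite raddf_sum /=.
  have [/forallP aB|] := boolP [forall i, a i < B.+1]%N.
    pose a' : {ffun 'I_m -> 'I_B.+1} := [ffun i => Ordinal (aB i)].
    have -> : a = col a' by apply/mnmP => i; rewrite mnmE ffunE.
    by rewrite -[RHS](crel a'); apply: eq_bigr => t _; rewrite mcoeffCM.
  (* Outside the box some exponent exceeds [B], hence so does the total degree, and no image of a
     [mon t] has such a monomial. *)
  rewrite negb_forall => /existsP[i]; rewrite -leqNgt => aB.
  apply: big1 => t; rewrite inE => /pffun_onP[/subsetP tA _].
  rewrite mcoeffCM /subst mmapX memN_msupp_eq0 ?mulr0 //.
  have degt : deg_le (\sum_j d * mon t j) (mmap1 w (mon t)).
    by apply: deg_le_prod => j; apply: deg_leX.
  apply: contraL aB => /degt.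
  move=> aw; rewrite -ltnNge ltnS; apply: (@leq_trans (mdeg a)).
    by rewrite mdegE (bigD1 i) //= leq_addr.
  apply: (leq_trans aw); rewrite (bigID (mem A)) /= [X in (_ + X)%N]big1 => [|j jA].
    rewrite addn0 /B -mulnA -sum_nat_const; apply: leq_sum => j _.
    by rewrite mnmE leq_mul2l -ltnS ltn_ord orbT.
  by rewrite mnmE; have [->|/(tA j)] := eqVneq (t j) ord0; rewrite ?muln0 ?(negPf jA).
by move: ct0; rewrite -Gco // G0 mcoeff0 eqxx.
Qed.

End AlgebraicIndependence.

(** * The Jacobian criterion *)

Section JacobianCriterion.
Context (k : fieldType) (k0 : [pchar k] =i pred0) (m : nat).

(** A nonzero relation of least size works, as its derivatives are smaller. Classically: if no such
    [G] existed, strong induction on the size would make every relation zero. *)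
Lemma min_relation n (w : 'I_n -> {mpoly k[m]}) A : ~ alg_indep w A ->
  exists G, [/\ in_subring A G, G != 0, subst w G = 0 &
    forall i, subst w G^`M(i) = 0 -> G^`M(i) = 0].
Proof.
move=> Adep; apply: NNPP => nomin; apply: Adep => G.
have [s] := ubnP (msize G); elim: s G => // s IHs G /ltnSE-leGs GA wG0.
apply/eqP; apply: contraT => nzG; case: nomin; exists G; split=> // i wdG.
apply: IHs => //; last exact: in_subring_mderiv.
exact: leq_trans (msize_mderiv i nzG) leGs.
Qed.

Local Notation "x %:F" := (@FracField.tofrac _ x).

Definition grad n (w : 'I_n -> {mpoly k[m]}) (e : 'I_n) :
  'rV[{fraction {mpoly k[m]}}]_m := \row_j ((w e)^`M(j))%:F.

(** The chain rule applied to [subst w G = 0]; variables outside [A] contribute zero derivatives. *)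
Lemma grad_relation n (w : 'I_n -> {mpoly k[m]}) A G :
    in_subring A G -> subst w G = 0 ->
  \sum_(i in A) (subst w G^`M(i))%:F *: grad w i = 0.
Proof.
move=> GA wG0; apply/rowP => j; rewrite summxE mxE.
have := mmap_derivation (h := @mpolyC m k) w (D := mderiv j) (mderivM j) (mderivC j) G.
rewrite -/(subst w G) wG0 raddf0 (bigID (mem A)) /= [X in _ + X]big1 => [|i iA]; last first.
  by rewrite (mderiv_notin GA iA) mmap0 mul0r.
rewrite addr0 => /(congr1 (@FracField.tofrac _)); rewrite rmorph0 rmorph_sum => e; rewrite [RHS]e.
by apply: eq_bigr => i _; rewrite !mxE rmorphM.
Qed.

(** Otherwise freeness kills all coefficients of the gradient relation of a minimal [G]. By
    minimality the derivatives of [G] are then zero, so [G] is a nonzero constant, which is no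
    relation. *)
Lemma grad_free_alg_indep n (w : 'I_n -> {mpoly k[m]}) A :
  lin_indep (grad w) A -> alg_indep w A.
Proof.
move=> Afree; apply: NNPP => /min_relation[G [GA nzG wG0 Gmin]].
have wdG0 := Afree (fun i => (subst w G^`M(i))%:F) (grad_relation GA wG0).
have GC : G = (G@_0)%:MP.
  apply: (mderiv_all_eq0 k0 GA) => i /wdG0 /eqP; rewrite tofrac_eq0 => /eqP; exact: Gmin.
move: wG0 nzG; rewrite GC /subst mmapC => /eqP.
by rewrite /= mpolyC_eq0 => /eqP->; rewrite mpolyC0 eqxx.
Qed.

Lemma alg_indep_maximal n (w : 'I_n -> {mpoly k[m]}) A : alg_indep w A ->
  exists B : {set 'I_n}, [/\ A \subset B, alg_indep w B &
    forall e, e \notin B -> ~ alg_indep w (e |: B)].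
Proof.
have [s] := ubnP #|~: A|; elim: s A => // s IHs A /ltnSE-leAs Aind.
have [[e eA eAind]|Amax] := classic (exists2 e, e \notin A & alg_indep w (e |: A)); last first.
  by exists A; split=> // e eA eAind; apply: Amax; exists e.
have [|B [sAB Bind Bmax]] := IHs (e |: A) _ eAind.
  apply: leq_trans leAs; apply: proper_card; rewrite properC.
  by rewrite setUC properUl // sub1set.
by exists B; split=> //; apply: subset_trans sAB; apply: subsetUr.
Qed.

Lemma grad_in_span n (w : 'I_n -> {mpoly k[m]}) (B : {set 'I_n}) e :
    alg_indep w B -> (e \notin B -> ~ alg_indep w (e |: B)) ->
  (grad w e <= rows_in (grad w) B)%MS.
Proof.
move=> Bind Bmax; have [eB|eB] := boolP (e \in B); first exact: row_in_sub.
have [G [GB nzG wG0 Gmin]] := min_relation (Bmax eB).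
(* A minimal relation on [e |: B] must involve [e], as otherwise it would be a relation on [B].
   Hence the gradient relation can be solved for [grad w e]. *)
have nz_c : (subst w G^`M(e))%:F != 0.
  rewrite tofrac_eq0; apply: contraNneq nzG => /Gmin dG0; apply/eqP/Bind => //.
  apply/in_subringP => a aG i ai; move/in_subringP/(_ a aG i ai): GB.
  by rewrite inE => /orP[/set1P ie|//]; rewrite ie (mderiv_eq0 k0 dG0 aG) in ai.
have := grad_relation GB wG0; rewrite big_setU1 //= => /eqP; rewrite addr_eq0 => /eqP rel.
rewrite -[grad w e]scale1r -(mulVf nz_c) -scalerA rel.
apply: scalemx_sub; rewrite eqmx_opp; apply: summx_sub => i iB.
by apply: scalemx_sub; apply: row_in_sub.
Qed.

(* A maximal algebraically independent set among the [f i] and the coordinates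
   has at most [m] elements, and its gradients span the whole space since those
   of the coordinates do. *)
Lemma alg_indep_grad_free n (f : 'I_n -> {mpoly k[m]}) (I : {set 'I_n}) :
  alg_indep f I -> lin_indep (grad f) I.
Proof.
move=> Iind.
pose w (e : 'I_(n + m)) := match split e with inl i => f i | inr j => 'X_j end.
have wl i : w (lshift m i) = f i by rewrite /w (unsplitK (inl i)).
have wr j : w (rshift n j) = 'X_j by rewrite /w (unsplitK (inr j)).
pose A := lshift m @: I.
have Aind : alg_indep w A.
  move=> G GA.
  (* Renaming variables turns a relation on [A] into one on [I]. *)
  have [G' [G'I -> ->]] : exists G', [/\ in_subring I G',
      G = mmap (@mpolyC (n + m) k) (fun i => 'X_(lshift m i)) G' & subst w G = subst f G'].
    elim: GA => {G} [c|i /imsetP[j Ij ->]|p q _ [p' [p'I -> ep]] _ [q' [q'I -> eq]]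
        |p q _ [p' [p'I -> ep]] _ [q' [q'I -> eq]]].
    - by exists c%:MP; rewrite /subst !mmapC; split=> //; constructor.
    - by exists 'X_j; rewrite /subst !mmapX !mmap1U wl; split=> //; constructor.
    - exists (p' + q'); rewrite /subst !mmapD; split=> //; first by constructor.
      by congr (_ + _).
    - exists (p' * q'); rewrite /subst !rmorphM; split=> //; first by constructor.
      by congr (_ * _).
  by move=> /(Iind _ G'I) ->; rewrite mmap0.
have [B [sAB Bind Bmax]] := alg_indep_maximal Aind.
have spanB e : (grad w e <= rows_in (grad w) B)%MS.
  by apply: grad_in_span Bind _; apply: Bmax.
have fullB : (1%:M <= rows_in (grad w) B)%MS.
  apply/row_subP => j; suff -> : row j 1%:M = grad w (rshift n j) by apply: spanB.
  apply/rowP => i; rewrite !mxE wr mderivX mnm1E.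
  case: eqP => [->|_]; last by rewrite scale0r rmorph0.
  by rewrite scale1r -[X in (X - _)%MM]add0m addmK mpolyX0 rmorph1.
(* At most [m] rows spanning a space of dimension [m] are independent. *)
have Bfree : lin_indep (grad w) B.
  apply/lin_indepP; rewrite /row_free eqn_leq rank_leq_row /=.
  apply: leq_trans (alg_indep_card Bind) _.
  by have := mxrankS fullB; rewrite mxrank1.
have Afree := lin_indepS sAB Bfree.
move=> c c0 i Ii.
pose c' (e : 'I_(n + m)) := match split e with inl i => c i | inr _ => 0 end.
have c'l j : c' (lshift m j) = c j by rewrite /c' (unsplitK (inl j)).
rewrite -c'l; apply: Afree; last by apply: imset_f.
rewrite big_imset /= => [|? ? _ _]; last exact: lshift_inj.
rewrite -[RHS]c0; apply: eq_bigr => j _; rewrite c'l; congr (_ *: _).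
by apply/rowP => l; rewrite !mxE wl.
Qed.

End JacobianCriterion.

(** * Specialization *)

Lemma map_mpoly_eq0 (k' k : fieldType) (iota : {rmorphism k' -> k}) m (p : {mpoly k'[m]}) :
  (map_mpoly iota p == 0) = (p == 0).
Proof.
apply/eqP/eqP => [p0|->]; last by rewrite rmorph0.
by apply/mpolyP => a; apply/(fmorph_inj iota); rewrite -mcoeff_map_mpoly p0 !mcoeff0 rmorph0.
Qed.

Lemma mderiv_map_mpoly (k' k : fieldType) (iota : {rmorphism k' -> k}) m
    (p : {mpoly k'[m]}) i : (map_mpoly iota p)^`M(i) = map_mpoly iota p^`M(i).
Proof.
by apply/mpolyP => a; rewrite !(mcoeff_mderiv, mcoeff_map_mpoly) /= ?rmorphMn.
Qed.

Lemma defined_over_descent (k' k : fieldType) (iota : {rmorphism k' -> k}) m n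
    (f : poly_map k m n) :
  defined_over iota f -> exists g : poly_map k' m n, forall i, f i = map_mpoly iota (g i).
Proof.
(* Boolean equality lets [xchoose] pick the coefficients as a function. *)
move=> hf; have hf' i a : exists c, (f i)@_a == iota c by have [c ->] := hf i a; exists c.
pose c i a := xchoose (hf' i a).
exists (fun i => \sum_(a <- msupp (f i)) c i a *: 'X_[a]) => i.
rewrite rmorph_sum [LHS]mpolyE; apply: eq_bigr => a _.
by rewrite /= map_mpolyZ map_mpolyX -(eqP (xchooseP (hf' i a))).
Qed.

(** The product of the nonzero [Q t] is nonzero, so it does not vanish everywhere. *)
Lemma generic_point (k : fieldType) (k0 : [pchar k] =i pred0) m (T : finType)
    (Q : T -> {mpoly k[m]}) :
  exists z : 'I_m -> k, forall t, Q t != 0 -> (Q t).@[z] != 0.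
Proof.
have [z zQ] : exists z, (\prod_(t | Q t != 0) Q t).@[z] <> 0.
  apply: not_all_ex_not => /(mpoly_vanish_eq0 k0)/eqP; apply/negP.
  by apply/prodf_neq0.
exists z => t Qt; move/eqP: zQ; rewrite rmorph_prod => /prodf_neq0; exact.
Qed.

Lemma vanishing_idealE (k : fieldType) (k0 : [pchar k] =i pred0) m n
    (f : poly_map k m n) g : vanishing_ideal f g <-> subst f g = 0.
Proof.
have evf z : (subst f g).@[z] = g.@[poly_map_eval f z].
  elim: (in_subringT g) => {g} [c|i _|p q _ IHp _ IHq|p q _ IHp _ IHq].
  - by rewrite /subst mmapC !mevalC.
  - by rewrite /subst mmapX mmap1U mevalXU.
  - by rewrite mevalD -IHp -IHq -mevalD /subst mmapD.
  - by rewrite mevalM -IHp -IHq -mevalM /subst rmorphM.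
split=> [gf|gf z]; last by rewrite -evf gf meval0.
by apply: (mpoly_vanish_eq0 k0) => z; rewrite evf.
Qed.

Theorem theorem3p3 (k k' : fieldType) (iota : {rmorphism k' -> k})
    (hchar : [pchar k] =i pred0) (m n : nat) (f : poly_map k m n)
    (hf : defined_over iota f) :
  exists M : matroid 'I_n,
    is_algebraic_matroid (vanishing_ideal f) M /\ representable k' M.
Proof.
have k'0 : [pchar k'] =i pred0 by move=> p; rewrite -(fmorph_pchar iota) hchar.
have [g fg] := defined_over_descent hf.
pose v e : 'rV[{mpoly k'[m]}]_m := \row_j (g e)^`M(j).
(* The finite family consists of the maximal minors for all row sets [I] at once, so that one [z]
   serves every [I]. *)
have [z zP] := generic_point k'0
  (fun t : {I : {set 'I_n} & {ffun 'I_#|I| -> 'I_m}} =>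
     \det (colsub (tagged t) (rows_in v (tag t)))).
pose phi e := map_mx (meval z) (v e).
exists (linear_matroid phi); split; last by exists 'rV[k']_m, phi.
move=> I.
have gradE e : grad f e = map_mx (@FracField.tofrac _ \o map_mpoly iota) (v e).
  by apply/rowP => j; rewrite !mxE fg mderiv_map_mpoly.
(* Both sides are read off the same minors over [k']. A minor that is nonzero at [z] is a nonzero
   polynomial, and the choice of [z] gives the converse; base change to [k] and passage to fractions
   are injective. *)
have specialize : lin_indep phi I <-> lin_indep (grad f) I.
  split=> /lin_indep_minor[h h0]; apply/lin_indep_minor; exists h.
    rewrite (minor_map h gradE) /= tofrac_eq0 map_mpoly_eq0.
    apply: contraNneq h0 => h0.
    by rewrite (minor_map (phi := meval z) (v := v)) // h0 rmorph0.
  rewrite (minor_map (phi := meval z) (v := v)) //.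
  apply: (zP (existT _ I h)); move: h0.
  by rewrite (minor_map h gradE) /= tofrac_eq0 map_mpoly_eq0.
apply: (iff_trans specialize); split=> [Ifree G|Ivan].
  split=> [[/(vanishing_idealE hchar) fG0 GI]|->].
    exact: (grad_free_alg_indep hchar Ifree).
  split; first by move=> x; rewrite meval0.
  by rewrite -mpolyC0; constructor.
apply: (alg_indep_grad_free hchar) => G GI fG0.
by apply/Ivan; split=> //; apply/(vanishing_idealE hchar).
Qed.
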